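(* Let $(X,\xi)$ and $(Y,\eta)$ be pointed coarse spaces. If coarse maps $f,g\colon(X,\xi)\to(Y,\eta)$ are bornotopic, then so are the maps $S(f),S(g)\colon S(X,\xi)\to S(Y,\eta)$.
   Context: For binary relations $E,F\subseteq X\times X$: $E\circ F=\{(x,y) : (x,z)\in E \text{ and } (z,y)\in F \text{ for some } z\in X\}$, $E^{-1}=\{(y,x):(x,y)\in E\}$, $E^0=\Delta_X=\{(x,x):x\in X\}$, $E^{n+1}=E^n\circ E$. For maps $f,g\colon X\to Y$, $(f\times g)(E)=\{(f(x),g(y)):(x,y)\in E\}$. A coarse structure on a set $X$ is a family $\mathcal{C}_X$ of binary relations on $X$ such that $\Delta_X\in\mathcal{C}_X$; $E\subseteq F\in\mathcal{C}_X$ implies $E\in\mathcal{C}_X$; and $E,F\in\mathcal{C}_X$ implies $E\cup F, E\circ F, E^{-1}\in\mathcal{C}_X$. A set with a coarse structure is a coarse space; a pointed coarse space $(X,\xi)$ is a coarse space $X$ with a base point $\xi\in X$. A subset $A\subseteq X$ is bounded if $A\times A\in\mathcal{C}_X$; $\mathcal{B}_X$ is the family of bounded subsets. Metrics are allowed to take the value $\infty$. A metric space $(X,d)$ is endowed with the bounded coarse structure $\{E\subseteq X\times X : \sup d(E)<\infty\}\cup\{\varnothing\}$. $\mathbb{N}$ (containing $0$) carries its usual metric. A map $f\colon X\to Y$ between coarse spaces is proper if $f^{-1}(B)\in\mathcal{B}_X$ for all $B\in\mathcal{B}_Y$; bornologous if $(f\times f)(E)\in\mathcal{C}_Y$ for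 all $E\in\mathcal{C}_X$; coarse if it is proper and bornologous. A coarse map $(X,\xi)\to(Y,\eta)$ of pointed coarse spaces is a coarse map $X\to Y$ sending $\xi$ to $\eta$. Maps $f,g\colon X\to Y$ into a coarse space $Y$ are bornotopic (close) if $(f\times g)(\Delta_X)\in\mathcal{C}_Y$. $S(X,\xi)$ is the set of all coarse maps $s\colon(\mathbb{N},0)\to(X,\xi)$ (coarse sequences). For $s,t\in S(X,\xi)$ write $s\sqsubseteq^{\sigma}_{X,\xi}t$ if $s$ is a subsequence of $t$, i.e. $s=t\circ\kappa$ for some strictly increasing $\kappa\colon\mathbb{N}\to\mathbb{N}$; $\sqsupseteq^{\sigma}_{X,\xi}$ is the inverse relation. $S(X,\xi)$ is equipped with the metric $d_{S(X,\xi)}(s,t)=\inf\{n\in\mathbb{N} : (s,t)\in(\sqsubseteq^{\sigma}_{X,\xi}\cup\sqsupseteq^{\sigma}_{X,\xi})^n\}\in\mathbb{N}\cup\{\infty\}$, with $\inf\varnothing=\infty$, and with the induced bounded coarse structure. For a coarse map $f\colon(X,\xi)\to(Y,\eta)$, $S(f)\colon S(X,\xi)\to S(Y,\eta)$ is the map $S(f)(s)=f\circ s$. *)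

(* Defs.v *)
From HB Require Import structures.
From mathcomp Require Import all_boot all_order all_algebra.
From mathcomp Require Import all_classical all_reals ereal Rstruct.

Set Implicit Arguments.
Unset Strict Implicit.
Unset Printing Implicit Defensive.

Import Order.TTheory GRing.Theory Num.Theory.

Local Open Scope classical_set_scope.
Local Open Scope relation_scope.

(* In relation_scope, [B \; A] relates x to y when A x z and B z y for some z:
   the composition written E o F in the text is [F \; E]. *)

HB.mixin Record isCoarse (X : Type) := {
  controlled : set (set (X * X)) ;
  controlled_diagonal : controlled diagonal ;
  controlled_sub : forall E F : set (X * X),
    E `<=` F -> controlled F -> controlled E ;
  controlledU : forall E F : set (X * X),
    controlled E -> controlled F -> controlled (E `|` F) ;
  controlled_comp : forall E F : set (X * X),
    controlled E -> controlled F -> controlled (F \; E) ;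
  controlled_inv : forall E : set (X * X),
    controlled E -> controlled (E^-1)
}.

#[short(type="coarseType")]
HB.structure Definition Coarse := {X of isCoarse X}.

Definition bounded_subset {X : coarseType} (A : set X) : Prop :=
  controlled (A `*` A).

Definition prod_map {X X' Y Y' : Type} (f : X -> Y) (g : X' -> Y')
    (p : X * X') : Y * Y' := (f p.1, g p.2).

Definition proper_map {X Y : coarseType} (f : X -> Y) : Prop :=
  forall B : set Y, bounded_subset B -> bounded_subset (f @^-1` B).

Definition bornologous {X Y : coarseType} (f : X -> Y) : Prop :=
  forall E : set (X * X), controlled E -> controlled (prod_map f f @` E).

Definition coarse_map {X Y : coarseType} (f : X -> Y) : Prop :=
  proper_map f /\ bornologous f.

Definition bornotopic {X : Type} {Y : coarseType} (f g : X -> Y) : Prop :=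
  controlled (prod_map f g @` diagonal).

Record pcoarse_map (X Y : coarseType) (xi : X) (eta : Y) := PCoarseMap {
  pcoarse_fun :> X -> Y ;
  pcoarse_coarse : coarse_map pcoarse_fun ;
  pcoarse_base : pcoarse_fun xi = eta
}.

Lemma pcoarse_mapP (X Y : coarseType) (xi : X) (eta : Y)
    (s t : pcoarse_map xi eta) : (s : X -> Y) = t -> s = t.
Proof.
case: s t => [s cs bs] [t ct bt] /= st; subst t.
by congr PCoarseMap; exact: Prop_irrelevance.
Qed.

Lemma coarse_map_comp (X Y Z : coarseType) (f : X -> Y) (g : Y -> Z) :
  coarse_map f -> coarse_map g -> coarse_map (g \o f).
Proof.
move=> [pf bf] [pg bg]; split=> [B /pg /pf //|E /bf /bg].
by apply: controlled_sub => _ [p Ep <-]; exists (prod_map f f p) => //; exists p.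
Qed.

Definition pcoarse_comp (X Y Z : coarseType) (xi : X) (eta : Y) (zeta : Z)
    (g : pcoarse_map eta zeta) (f : pcoarse_map xi eta) :
    pcoarse_map xi zeta :=
  @PCoarseMap X Z xi zeta (g \o f)
    (coarse_map_comp (pcoarse_coarse f) (pcoarse_coarse g))
    (etrans (congr1 g (pcoarse_base f)) (pcoarse_base g)).

Local Notation real := Rdefinitions.R.

(* Metrics may take the value +oo. *)
HB.mixin Record isEMetric (X : Type) := {
  edist : X -> X -> \bar real ;
  edist_ge0 : forall x y : X, (0 <= edist x y)%E ;
  edist_eq0 : forall x y : X, edist x y = 0%E <-> x = y ;
  edistC : forall x y : X, edist x y = edist y x ;
  edist_triangle : forall x y z : X, (edist x z <= edist x y + edist y z)%E
}.

#[short(type="emetricType")]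
HB.structure Definition EMetric := {X of isEMetric X}.

Section BoundedCoarse.
Variable X : emetricType.
Implicit Types E F : set (X * X).

Definition bounded_coarse : set (set (X * X)) :=
  [set E | (ereal_sup [set edist p.1 p.2 | p in E] < +oo)%E] `|` [set set0].

Lemma bounded_coarseP E :
  bounded_coarse E <->
  exists M : real, forall x y : X, E (x, y) -> (edist x y <= M%:E)%E.
Proof.
split=> [[Efin|->]|[M EM]].
- have Ele x y : E (x, y) -> (edist x y <= ereal_sup
      [set edist p.1 p.2 | p in E])%E.
    by move=> Exy; apply: ereal_sup_ubound; exists (x, y).
  move: Efin Ele; rewrite /=; set u := ereal_sup _.
  case: u => [r _ rE|//|_ rE]; first by exists r.
  by exists 0%R => x y /rE; rewrite leeNy_eq => /eqP ->; rewrite leNye.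
- by exists 0%R.
- left; apply: (@le_lt_trans _ _ M%:E); last exact: ltry.
  by apply: ge_ereal_sup => _ [[x y] Exy <-]; exact: EM.
Qed.

Lemma bounded_coarse_diagonal : bounded_coarse diagonal.
Proof.
apply/bounded_coarseP; exists 0%R => x _ /diagonalP <-.
by rewrite (edist_eq0 x x).2.
Qed.

Lemma bounded_coarse_sub E F :
  E `<=` F -> bounded_coarse F -> bounded_coarse E.
Proof.
move=> EF /bounded_coarseP[M FM]; apply/bounded_coarseP.
by exists M => x y /EF /FM.
Qed.

Lemma bounded_coarseU E F :
  bounded_coarse E -> bounded_coarse F -> bounded_coarse (E `|` F).
Proof.
move=> /bounded_coarseP[M EM] /bounded_coarseP[N FN]; apply/bounded_coarseP.
exists (Num.max M N) => x y [/EM|/FN] /le_trans; apply;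
  by rewrite lee_fin le_max lexx ?orbT.
Qed.

Lemma bounded_coarse_comp E F :
  bounded_coarse E -> bounded_coarse F -> bounded_coarse (F \; E).
Proof.
move=> /bounded_coarseP[M EM] /bounded_coarseP[N FN]; apply/bounded_coarseP.
exists (M + N)%R => x y [z /= /EM xz /FN zy].
by apply: (le_trans (edist_triangle x z y)); rewrite EFinD leeD.
Qed.

Lemma bounded_coarse_inv E : bounded_coarse E -> bounded_coarse (E^-1).
Proof.
move=> /bounded_coarseP[M EM]; apply/bounded_coarseP.
by exists M => x y /= /EM; rewrite edistC.
Qed.

Definition bounded_coarse_mixin : isCoarse X :=
  isCoarse.Build X bounded_coarse_diagonal bounded_coarse_sub bounded_coarseU
    bounded_coarse_comp bounded_coarse_inv.

End BoundedCoarse.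

Section NatMetric.

Definition nat_edist (m n : nat) : \bar real := (`|m%:R - n%:R|%R)%:E.

Lemma nat_edist_ge0 m n : (0 <= nat_edist m n)%E.
Proof. by rewrite lee_fin normr_ge0. Qed.

Lemma nat_edist_eq0 m n : nat_edist m n = 0%E <-> m = n.
Proof.
split=> [[] /eqP|->]; last by rewrite /nat_edist subrr normr0.
by rewrite normr_eq0 subr_eq0 eqr_nat => /eqP.
Qed.

Lemma nat_edistC m n : nat_edist m n = nat_edist n m.
Proof. by rewrite /nat_edist distrC. Qed.

Lemma nat_edist_triangle m n p :
  (nat_edist m p <= nat_edist m n + nat_edist n p)%E.
Proof. by rewrite -EFinD lee_fin ler_distD. Qed.

HB.instance Definition _ :=
  isEMetric.Build nat nat_edist_ge0 nat_edist_eq0 nat_edistC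
    nat_edist_triangle.

HB.instance Definition _ : isCoarse nat := bounded_coarse_mixin nat.

End NatMetric.

Definition relpow {T : Type} (E : set (T * T)) (n : nat) : set (T * T) :=
  iter n (fun G => E \; G) diagonal.

Lemma relpowD {T : Type} (E : set (T * T)) m n x y z :
  relpow E m (x, y) -> relpow E n (y, z) -> relpow E (m + n) (x, z).
Proof.
move=> xy; elim: n z => [|n IHn] z; first by move=> /diagonalP <-; rewrite addn0.
by move=> [w /= /IHn xw wz]; rewrite addnS; exists w.
Qed.

Lemma relpow_sym {T : Type} (E : set (T * T)) n x y :
  E^-1 `<=` E -> relpow E n (x, y) -> relpow E n (y, x).
Proof.
move=> Esym; elim: n y => [|n IHn] y; first by move=> /diagonalP ->.
move=> [w /= /IHn wx wy]; apply: (@relpowD _ E 1 n _ w) wx.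
by exists y => //; exact: Esym.
Qed.

Section CoarseSequences.
Variables (X : coarseType) (xi : X).

Definition coarse_seq := pcoarse_map (0%N : nat) xi.

Definition subsequence (s t : coarse_seq) : Prop :=
  exists2 kappa : nat -> nat, {homo kappa : m n / (m < n)%N} &
    (s : nat -> X) = t \o kappa.

Definition subseq_rel : set (coarse_seq * coarse_seq) :=
  [set p | subsequence p.1 p.2].

Definition seq_steps (n : nat) : set (coarse_seq * coarse_seq) :=
  relpow (subseq_rel `|` subseq_rel^-1) n.

Definition seq_edist (s t : coarse_seq) : \bar real :=
  ereal_inf [set (n%:R : real)%:E | n in [set n : nat | seq_steps n (s, t)]].

Lemma seq_edist_cases s t :
  (exists2 n : nat, seq_steps n (s, t) & seq_edist s t = (n%:R : real)%:E) \/
  seq_edist s t = +oo%E.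
Proof.
have [[n0 n0P]|none] := pselect (exists n, seq_steps n (s, t)); last first.
  right; apply/ereal_inf_pinfty => x [n nP _].
  by case: none; exists n.
have ex : exists n, `[< seq_steps n (s, t) >] by exists n0; apply/asboolP.
have [n /asboolP nP nmin] := ex_minnP ex; left; exists n => //.
apply/eqP; rewrite eq_le; apply/andP; split.
  by apply: ereal_inf_lbound; exists n.
apply: le_ereal_inf_tmp => _ [m mP <-].
by rewrite lee_fin ler_nat; apply: nmin; apply/asboolP.
Qed.

Lemma seq_edist_le n s t :
  seq_steps n (s, t) -> (seq_edist s t <= (n%:R : real)%:E)%E.
Proof. by move=> nP; apply: ereal_inf_lbound; exists n. Qed.

Lemma seq_steps_sym n s t : seq_steps n (s, t) -> seq_steps n (t, s).
Proof. by apply: relpow_sym => -[a b] /= [] ?; [right|left]. Qed.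

Lemma seq_edist_ge0 s t : (0 <= seq_edist s t)%E.
Proof.
by case: (seq_edist_cases s t) => [[n _]|] ->; rewrite ?lee_fin ?leey ?ler0n.
Qed.

Lemma seq_edist_eq0 s t : seq_edist s t = 0%E <-> s = t.
Proof.
split=> [st0|<-].
  case: (seq_edist_cases s t); rewrite st0; last by [].
  move=> [n nP [] /esym /eqP]; rewrite pnatr_eq0 => /eqP n0.
  by move: nP; rewrite n0 => /diagonalP.
apply/eqP; rewrite eq_le seq_edist_ge0 andbT.
by apply: (@seq_edist_le 0%N); apply/diagonalP.
Qed.

Lemma seq_edistC s t : seq_edist s t = seq_edist t s.
Proof.
by congr ereal_inf; apply/seteqP; split=> _ [n /seq_steps_sym nP <-]; exists n.
Qed.

Lemma seq_edist_triangle s t u :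
  (seq_edist s u <= seq_edist s t + seq_edist t u)%E.
Proof.
case: (seq_edist_cases s t) => [[m mP ->]|->]; last first.
  by rewrite addye ?leey // gt_eqF // (lt_le_trans _ (seq_edist_ge0 t u)).
case: (seq_edist_cases t u) => [[n nP ->]|->]; last by rewrite addey ?leey.
by rewrite -EFinD -natrD; apply: seq_edist_le; exact: relpowD mP nP.
Qed.

HB.instance Definition _ :=
  isEMetric.Build coarse_seq seq_edist_ge0 seq_edist_eq0 seq_edistC
    seq_edist_triangle.

HB.instance Definition _ : isCoarse coarse_seq :=
  bounded_coarse_mixin coarse_seq.

End CoarseSequences.

Definition coarse_seq_map {X Y : coarseType} {xi : X} {eta : Y}
    (f : pcoarse_map xi eta) : coarse_seq xi -> coarse_seq eta :=
  fun s => pcoarse_comp f s.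

(* Main.v *)
Require Import Defs.
From mathcomp Require Import all_boot all_order all_algebra zify.
From mathcomp Require Import all_classical all_reals ereal Rstruct.

Import Order.TTheory GRing.Theory Num.Theory.

Local Open Scope classical_set_scope.
Local Open Scope relation_scope.

(** For a coarse sequence [s] in [X], let [t] be the interleaving
    [f (s 0), g (s 0), f (s 1), g (s 1), ...].  Both [f \o s] and [g \o s] are
    subsequences of [t], so as soon as [t] is itself a coarse sequence the
    distance from [S(f)(s)] to [S(g)(s)] is at most [2], uniformly in [s].

    To see that [t] is coarse, compare it with [f \o s \o half], where [half]
    is [n |-> n./2]: the two sequences agree at even indices, and at the odd
    index [2 k + 1] they take the values [g (s k)] and [f (s k)], which are
    close because [f] and [g] are bornotopic.  Now [f \o s \o half] is a
    composite of coarse maps ([coarse_map_half]), and any map bornotopic to a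
    coarse map is coarse ([bornotopic_coarse_map]). *)

Lemma bornotopicE {X : Type} {Y : coarseType} (f g : X -> Y) :
  bornotopic f g <-> exists2 C : set (Y * Y),
    controlled C & forall x, C (f x, g x).
Proof.
split=> [fg|[C Cc fgC]].
  by exists (prod_map f g @` diagonal) => // x; exists (x, x).
apply: controlled_sub Cc => _ [[x y] /diagonalP /= <- <-].
exact: fgC.
Qed.

Lemma bornotopic_sym {X : Type} {Y : coarseType} (f g : X -> Y) :
  bornotopic f g -> bornotopic g f.
Proof.
move=> /bornotopicE[C Cc fgC]; apply/bornotopicE.
by exists (C^-1) => //; exact: controlled_inv.
Qed.

(** If [C] contains all pairs [(g x, f x)], then a pair [(g x, g y)] factors as
    [g x -> f x -> f y -> g y] through [C], [E] and [C^-1]. *)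
Lemma bornotopic_controlled_pairs {X : Type} {Y : coarseType} (f g : X -> Y)
    (E : set (Y * Y)) :
  bornotopic f g -> controlled E ->
  exists2 F : set (Y * Y), controlled F &
    forall x y, E (f x, f y) -> F (g x, g y).
Proof.
move=> /bornotopic_sym /bornotopicE[C Cc gfC] Ec.
exists (C^-1 \; (E \; C)).
  by apply: controlled_comp (controlled_inv _ Cc); exact: controlled_comp.
move=> x y Exy; exists (f y); last exact: gfC.
by exists (f x) => //; exact: gfC.
Qed.

(** Both properties of [f] transfer to [g] along closeness, which reduces the
    coarseness of an interleaving to that of a composite with [half]. *)
Lemma bornotopic_coarse_map {X Y : coarseType} (f g : X -> Y) :
  bornotopic f g -> coarse_map f -> coarse_map g.
Proof.
move=> fg [fprop fborn]; split=> [B Bb|E /fborn fE].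
- (* Preimages of [B] under [g] are mapped by [f] to a bounded set. *)
  have [F Fc BF] := bornotopic_controlled_pairs g f _ (bornotopic_sym _ _ fg) Bb.
  have fgB : bounded_subset (f @` (g @^-1` B)).
    apply: controlled_sub Fc => -[_ _] [/= [x Bx <-] [y By <-]].
    exact: BF.
  by apply: controlled_sub (fprop _ fgB) => -[x y] [/= Bx By];
    split; [exists x|exists y].
- have [F Fc EF] := bornotopic_controlled_pairs f g _ fg fE.
  apply: controlled_sub Fc => _ [[x y] Exy <-].
  by apply: EF; exists (x, y).
Qed.

Lemma nat_edist_leE (m n M : nat) :
  (edist m n <= (M%:R : Rdefinitions.R)%:E)%E =
  ((m <= n + M) && (n <= m + M))%N.
Proof.
rewrite /edist /= /nat_edist lee_fin ler_norml lerBlDl lerBrDl -natrD ler_nat.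
by rewrite lerBlDr -natrD ler_nat andbC (addnC n).
Qed.

Lemma nat_controlledP (E : set (nat * nat)) :
  controlled E <->
  exists M : nat, forall m n, E (m, n) -> (m <= n + M /\ n <= m + M)%N.
Proof.
split=> [/bounded_coarseP[r Er]|[M EM]].
  exists (Num.truncn r).+1 => m n /Er mnr; apply/andP.
  rewrite -nat_edist_leE (le_trans mnr) // lee_fin.
  exact/ltW/truncnS_gt.
apply/bounded_coarseP; exists M%:R%R => m n /EM /andP.
by rewrite nat_edist_leE.
Qed.

Lemma coarse_map_half : coarse_map half.
Proof.
split=> [B /nat_controlledP[M BM]|E /nat_controlledP[M EM]];
  apply/nat_controlledP.
- (* The fibres of [half] have diameter 1, whence the extra unit. *)
  exists (M.*2.+1) => m n [/= Bm Bn].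
  have [] := BM m./2 n./2 (conj Bm Bn); lia.
- exists M => _ _ [[m n] /EM[mn nm] [<- <-]] /=; lia.
Qed.

Definition interleave {T : Type} (u v : nat -> T) (n : nat) : T :=
  if odd n then v n./2 else u n./2.

Lemma interleave_double {T : Type} (u v : nat -> T) n :
  interleave u v n.*2 = u n.
Proof. by rewrite /interleave odd_double doubleK. Qed.

Lemma interleave_doubleS {T : Type} (u v : nat -> T) n :
  interleave u v n.*2.+1 = v n.
Proof. by rewrite /interleave /= odd_double /= uphalf_double. Qed.

Lemma bornotopic_interleave {X : coarseType} (u v : nat -> X) :
  bornotopic u v -> bornotopic (u \o half) (interleave u v).
Proof.
move=> /bornotopicE[C Cc uvC]; apply/bornotopicE; exists (C `|` diagonal).
  by apply: controlledU => //; exact: controlled_diagonal.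
by move=> n; rewrite /interleave /=; case: odd; [left|right].
Qed.

Section InterleaveCoarseSeq.
Context {X : coarseType} {xi : X} (s t : coarse_seq xi).
Hypothesis st : bornotopic s t.

Lemma interleave_coarse_map : coarse_map (interleave s t).
Proof.
apply: (bornotopic_coarse_map _ _ (bornotopic_interleave _ _ st)).
exact: coarse_map_comp coarse_map_half (pcoarse_coarse s).
Qed.

Definition interleave_seq : coarse_seq xi :=
  @PCoarseMap nat X 0%N xi (interleave s t) interleave_coarse_map
    (pcoarse_base s).

Lemma subsequence_interleavel : subsequence s interleave_seq.
Proof.
exists double => [m n|]; first by rewrite ltn_double.
by apply/funext => n /=; rewrite interleave_double.
Qed.

Lemma subsequence_interleaver : subsequence t interleave_seq.
Proof.
exists (fun n => n.*2.+1) => [m n|]; first by rewrite ltnS ltn_double.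
by apply/funext => n /=; rewrite interleave_doubleS.
Qed.

(** The path is [s], [interleave_seq], [t]: one step up, one step down. *)
Lemma bornotopic_seq_edist_le2 : (edist s t <= (2%:R : Rdefinitions.R)%:E)%E.
Proof.
apply: (@seq_edist_le _ _ 2); exists interleave_seq.
  exists s; first exact/diagonalP.
  by left; exact: subsequence_interleavel.
by right; exact: subsequence_interleaver.
Qed.

End InterleaveCoarseSeq.

Theorem theorem3p3 (X Y : coarseType) (xi : X) (eta : Y)
    (f g : pcoarse_map xi eta) :
  bornotopic f g -> bornotopic (coarse_seq_map f) (coarse_seq_map g).
Proof.
move=> /bornotopicE[C Cc fgC]; apply/bounded_coarseP; exists 2%:R%R.
move=> _ _ [[s s'] /diagonalP /= <- [<- <-]].
apply: bornotopic_seq_edist_le2; apply/bornotopicE.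
by exists C => // n; exact: fgC.
Qed.
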